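(* For a real number $d$, let $\mathcal{G}_d$ be the class of graphs of maximum average degree at most $d$. If $d<6$, then $\mathcal{G}_d$ has bounded domination-to-2-independence ratio, i.e., there is a constant $C$ (depending on $d$) such that $\gamma(G)\le C\,\alpha_2(G)$ for every $G\in\mathcal{G}_d$. If $d\ge 6$, then $\mathcal{G}_d$ does not have domination tied to 2-independence, i.e., there is no function $h$ such that $\gamma(G)\le h(\alpha_2(G))$ holds for every $G\in\mathcal{G}_d$.
   Context: Graphs are finite, simple and undirected. The maximum average degree of a graph is the maximum of the average degrees of its (nonempty) subgraphs. For a graph $G$, the domination number $\gamma(G)$ is the minimum size of a set $D\subseteq V(G)$ such that every vertex of $G$ belongs to $D$ or has a neighbor in $D$. The 2-independence number $\alpha_2(G)$ is the maximum size of a set $A\subseteq V(G)$ such that the distance in $G$ between any two distinct vertices of $A$ is greater than two (vertices in different components are at infinite distance). *)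

(* Defs.v *)
From HB Require Import structures.
From mathcomp Require Import all_boot all_order all_algebra.
From mathcomp Require Import reals.

Set Implicit Arguments.
Unset Strict Implicit.
Unset Printing Implicit Defensive.

Import Order.TTheory GRing.Theory Num.Theory.

Record sgraph := SGraph {
  vertex :> finType;
  adj : rel vertex;
  adj_sym : symmetric adj;
  adj_irrefl : irreflexive adj }.

Definition edges (G : sgraph) : {set {set G}} :=
  [set e : {set G} | [exists x, exists y, adj x y && (e == [set x; y])]].

(* A pair (vertex set, edge set), not necessarily an induced subgraph. *)
Definition is_subgraph (G : sgraph) (H : {set G} * {set {set G}}) : bool :=
  (H.2 \subset edges G) && [forall e in H.2, e \subset H.1].

Definition degree (G : sgraph) (H : {set G} * {set {set G}}) (v : G) : nat :=
  #|[set e in H.2 | v \in e]|.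

Definition average_degree (R : realType) (G : sgraph)
    (H : {set G} * {set {set G}}) : R :=
  ((\sum_(v in H.1) degree H v)%:R / #|H.1|%:R)%R.

(* Average degrees are nonnegative, so the default value 0 only matters for
   the graph without vertices, whose maximum average degree is 0 by
   convention. *)
Definition mad (R : realType) (G : sgraph) : R :=
  \big[Num.max/0%R]_(H : {set G} * {set {set G}} |
     is_subgraph H && (H.1 != set0)) average_degree R H.

Definition dominating (G : sgraph) (D : {set G}) : bool :=
  [forall v, (v \in D) || [exists u in D, adj v u]].

Definition gamma (G : sgraph) : nat :=
  #|[arg min_(D < [set: G] | dominating D) #|D| ]|.

Definition walk (G : sgraph) (k : nat) (x y : G) : bool :=
  [exists p : k.-tuple G, path (@adj G) x p && (last x p == y)].

(* None stands for infinity. Searching the lengths below #|G| suffices, since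
   a shortest walk repeats no vertex; see dist_SomeP and dist_NoneP. *)
Definition dist (G : sgraph) (x y : G) : option nat :=
  ohead [seq k <- iota 0 #|G| | walk k x y].

Definition dist_gt (G : sgraph) (k : nat) (x y : G) : bool :=
  if dist x y is Some m then k < m else true.

Definition two_independent (G : sgraph) (A : {set G}) : bool :=
  [forall x in A, forall y in A, (x != y) ==> dist_gt 2 x y].

Definition alpha2 (G : sgraph) : nat :=
  \max_(A : {set G} | two_independent A) #|A|.

Definition mad_class (R : realType) (d : R) (G : sgraph) : Prop :=
  (mad R G <= d)%R.

Definition bounded_domination_ratio (R : realType) (K : sgraph -> Prop) : Prop :=
  exists C : R, forall G : sgraph, K G ->
    ((gamma G)%:R <= C * (alpha2 G)%:R)%R.

Definition domination_tied (R : realType) (K : sgraph -> Prop) : Prop :=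
  exists h : nat -> R, forall G : sgraph, K G ->
    ((gamma G)%:R <= h (alpha2 G))%R.

Lemma dominating_setT (G : sgraph) : dominating [set: G].
Proof. by apply/forallP => v; rewrite inE. Qed.

Lemma gammaP (G : sgraph) :
  (exists2 D : {set G}, dominating D & #|D| = gamma G) /\
  (forall D : {set G}, dominating D -> gamma G <= #|D|).
Proof.
rewrite /gamma; case: arg_minnP => [|D domD minD]; first exact: dominating_setT.
by split; first exists D.
Qed.

Lemma walkP (G : sgraph) k (x y : G) :
  reflect (exists p, [/\ path (@adj G) x p, last x p = y & size p = k])
          (walk k x y).
Proof.
apply: (iffP existsP) => [[p /andP[xp /eqP py]]|[p [xp py /eqP sp]]].
  by exists p; rewrite size_tuple.
by exists (Tuple sp); rewrite /= xp py eqxx.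
Qed.

Lemma walk_short (G : sgraph) k (x y : G) :
  walk k x y -> exists m, [/\ m <= k, m < #|G| & walk m x y].
Proof.
case/walkP => p [xp py sp].
case: (shortenP xp) py => q xq uq subq qy; exists (size q); split.
- rewrite -sp; apply: uniq_leq_size => //; by case/andP: uq.
- by have := card_uniqP uq => /= <-; apply: max_card.
- by apply/walkP; exists q.
Qed.

Lemma dist_SomeP (G : sgraph) k (x y : G) :
  dist x y = Some k <->
  walk k x y /\ forall m, walk m x y -> k <= m.
Proof.
rewrite /dist; set s := [seq _ <- _ | _].
have s_sorted : sorted leq s.
  by apply: sorted_filter; [exact: leq_trans | exact: iota_sorted].
have mem_s m : (m \in s) = walk m x y && (m < #|G|).
  by rewrite mem_filter mem_iota add0n.
split.
  case Es: s s_sorted => [|m t] //= st [<-{k}].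
  have := mem_s m; rewrite Es mem_head => /esym/andP[wm _]; split=> // n wn.
  have [n' [le_n' lt_n' wn']] := walk_short wn; apply: leq_trans le_n'.
  have : n' \in s by rewrite mem_s wn'.
  rewrite Es inE => /predU1P[->//|n't].
  exact: (allP (order_path_min leq_trans st)).
case=> wk mink; have [m [_ ltm wm]] := walk_short wk.
have ks : k \in s by rewrite mem_s wk (leq_ltn_trans (mink _ wm)).
case Es: s s_sorted ks => [|n t] //= st; rewrite inE => /predU1P[->//|kt].
have := mem_s n; rewrite Es mem_head => /esym/andP[wn _].
congr Some; apply/eqP; rewrite eqn_leq mink // andbT.
exact: (allP (order_path_min leq_trans st)).
Qed.

Lemma dist_NoneP (G : sgraph) (x y : G) :
  dist x y = None <-> ~~ connect (@adj G) x y.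
Proof.
split=> [dN|ncon].
  apply/negP => /connectP[p xp yp].
  have /walk_short[m [_ ltm wm]] : walk (size p) x y by apply/walkP; exists p.
  move: dN; rewrite /dist.
  have : m \in [seq k <- iota 0 #|G| | walk k x y].
    by rewrite mem_filter mem_iota wm.
  by case: filter.
case E: dist => [k|//]; case/dist_SomeP: E => /walkP[p [xp yp _]] _.
by case/negP: ncon; apply/connectP; exists p.
Qed.

(* Main.v *)
(** For [d < 6] the graph has an orientation of outdegree at most 5.  Let [S] be
    a maximal vertex set such that every vertex lies in at most [L] of the closed
    out-neighborhoods [N+[s]], [s \in S], and let [Sat] be the set of vertices
    attaining [L].  By maximality [N+[x]] meets [Sat] for every [x] outside [S],
    so [S :|: Sat] is dominating, while double counting gives
    [2 * #|Sat| <= #|S|]; hence [T := S :\: Sat] has size at least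
    [gamma G / 3].  The pairs of [T] at distance at most 2 are linearly many:
    the only ones not controlled by the outdegree and the load [L] are those
    with a common in-neighbor [x], and if [x] is outside [S :|: Sat] then it has,
    besides its two out-neighbors in [T], a third one in [Sat].  A vertex set in
    which each vertex has three neighbors in [T :|: Sat] is only a constant times
    larger than [T :|: Sat], because the average degree stays below 6.  So the
    conflict graph on [T] has bounded average degree, and an independent set of
    linear size.

    For [d >= 6], subdivide every edge of a complete graph and join an apex to
    all subdivision vertices: each edge has a subdivision vertex as an end, and
    these have degree 3; the 2-independence number is at most 2, but a vertex
    dominates at most two of the original vertices. *)

Require Import Defs.
From mathcomp Require Import all_boot all_order all_algebra.
From mathcomp Require Import reals.
From mathcomp Require Import zify lra.
Import Order.TTheory GRing.Theory Num.Theory.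

Set Implicit Arguments.
Unset Strict Implicit.
Unset Printing Implicit Defensive.

(** * Distinct vertices at distance at most two *)

Definition near2 (G : sgraph) (x y : G) : bool :=
  adj x y || [exists z, adj x z && adj z y].

Lemma near2_sym (G : sgraph) : symmetric (@near2 G).
Proof.
move=> x y; rewrite /near2 adj_sym; congr (_ || _).
by apply: eq_existsb => z; rewrite andbC adj_sym (adj_sym x).
Qed.

Lemma dist_gt2 (G : sgraph) (x y : G) :
  x != y -> dist_gt 2 x y = ~~ near2 x y.
Proof.
move=> xy; rewrite /dist_gt; apply/idP/idP => [|nxy].
  apply: contraL => nxy.
  have [k k2 wk] : exists2 k, k <= 2 & walk k x y.
    case/orP: nxy => [axy|/existsP[z /andP[xz zy]]].
      by exists 1 => //; apply/walkP; exists [:: y]; rewrite /= axy.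
    by exists 2 => //; apply/walkP; exists [:: z; y]; rewrite /= xz zy.
  case E: (dist x y) => [m|].
    by case/dist_SomeP: E => _ /(_ k wk) mk; rewrite -leqNgt (leq_trans mk).
  case/dist_NoneP/negP: E; case/walkP: wk => p [xp py _].
  by apply/connectP; exists p.
case E: (dist x y) => [m|//]; rewrite ltnNge.
apply: contra nxy => m2; case/dist_SomeP: E => /walkP[p [xp py sp]] _.
case: p xp py sp => [|a [|b [|c p]]] /=.
- by move=> _ exy; rewrite exy eqxx in xy.
- by rewrite andbT => xa <- _; rewrite /near2 xa.
- move=> /and3P[xa ab _] <- _; apply/orP; right.
  by apply/existsP; exists a; rewrite xa.
by move=> _ _ sp; move: m2; rewrite -sp.
Qed.

Lemma two_independentP (G : sgraph) (A : {set G}) :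
  reflect {in A &, forall x y, x != y -> ~~ near2 x y} (two_independent A).
Proof.
apply: (iffP forall_inP) => [indA x y xA yA xy|indA x xA].
  by have /forall_inP/(_ y yA)/implyP/(_ xy) := indA x xA; rewrite dist_gt2.
apply/forall_inP => y yA; apply/implyP => xy.
by rewrite dist_gt2 // indA.
Qed.

Lemma card_le_alpha2 (G : sgraph) (A : {set G}) :
  two_independent A -> #|A| <= alpha2 G.
Proof. by move=> indA; apply: leq_bigmax_cond. Qed.

(** * Double counting and independent sets of sparse relations *)

Section Counting.
Variable T : finType.
Implicit Types (A B : {set T}) (r : rel T).

Lemma card_bigcup_le (I : finType) (A : {set I}) (F : I -> {set T}) k :
  {in A, forall i, #|F i| <= k} -> #|\bigcup_(i in A) F i| <= #|A| * k.
Proof.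
move=> Fk; rewrite -sum_nat_const.
apply: (@leq_trans (\sum_(i in A) #|F i|)); last exact: leq_sum.
elim/big_rec2: _ => [|i m B _ le_m]; first by rewrite cards0.
by apply: leq_trans (leq_card_setU _ _) _; rewrite leq_add2l.
Qed.

Lemma double_counting (I : finType) (A : {set I}) B (e : I -> T -> bool) :
  \sum_(x in A) #|[set y in B | e x y]| =
  \sum_(y in B) #|[set x in A | e x y]|.
Proof.
transitivity (\sum_(x in A) \sum_(y in B) (e x y : nat)).
  apply: eq_bigr => x _; rewrite -sum1dep_card big_mkcondr /=.
  by apply: eq_bigr => y _; case: (e x y).
rewrite exchange_big; apply: eq_bigr => y _.
rewrite -sum1dep_card big_mkcondr /=.
by apply: eq_bigr => x _; case: (e x y).
Qed.

(** The closed neighborhoods of a maximal independent [B] cover [A], and each has at most [k.+1]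
    elements in [A]. *)
Lemma independent_of_degree_bound r A k : symmetric r ->
  {in A, forall x, #|[set y in A | (y != x) && r x y]| <= k} ->
  exists2 B : {set T}, B \subset A &
    {in B &, forall x y, x != y -> ~~ r x y} /\ #|A| <= #|B| * k.+1.
Proof.
move=> r_sym degA.
pose indep B := (B \subset A) &&
  [forall x in B, forall y in B, (x != y) ==> ~~ r x y].
have [|B maxB] := @ex_maxset T indep.
  exists set0; rewrite /indep sub0set; apply/forall_inP => x; by rewrite inE.
have /andP[BA /forall_inP indB] := maxsetp maxB.
have {}indB : {in B &, forall x y, x != y -> ~~ r x y}.
  by move=> x y xB yB; apply/implyP; move: y yB; apply/forall_inP/indB.
exists B => //; split=> //.
have cover : A \subset \bigcup_(x in B) (x |: [set y in A | (y != x) && r x y]).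
  apply/subsetP => y yA; apply: contraT => /bigcupP ny.
  have yB : y \notin B by apply/negP => yB; case: ny; exists y; rewrite ?setU11.
  have far x : x \in B -> ~~ r x y.
    move=> xB; apply/negP => rxy; case: ny; exists x => //.
    by rewrite !inE yA rxy !andbT orbN.
  have indyB : indep (y |: B).
    rewrite /indep subUset sub1set yA BA /=.
    apply/forall_inP => x xyB; apply/forall_inP => z zyB; apply/implyP.
    case/setU1P: xyB => [->|xB]; case/setU1P: zyB => [->|zB].
    - by rewrite eqxx.
    - by rewrite r_sym far.
    - by rewrite far.
    - exact: indB.
  have := maxsetsup maxB indyB (subsetUr _ _) => eqB.
  by rewrite -eqB setU11 in yB.
apply: leq_trans (subset_leq_card cover) _.
apply: card_bigcup_le => x /(subsetP BA) xA.
by rewrite cardsU1 -add1n leq_add ?leq_b1 ?degA.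
Qed.

(** By averaging, at least half of [A] has degree at most [c * 2]; the bounded-degree case is
    applied to that half. *)
Lemma independent_of_average_degree_bound r A c : symmetric r ->
  \sum_(x in A) #|[set y in A | (y != x) && r x y]| <= c * #|A| ->
  exists2 B : {set T}, B \subset A &
    {in B &, forall x y, x != y -> ~~ r x y} /\
    #|A| <= 2 * ((c * 2).+1 * #|B|).
Proof.
move=> r_sym sumA.
pose deg x := #|[set y in A | (y != x) && r x y]|.
pose A0 := [set x in A | deg x <= c * 2].
have A0A : A0 \subset A by apply/subsetP => x; rewrite inE => /andP[].
have le_A : #|A| <= 2 * #|A0|.
  have : (c * 2).+1 * #|A :\: A0| <= c * #|A|.
    apply: leq_trans sumA; rewrite mulnC -sum_nat_const.
    rewrite [leqRHS](big_setID A0) /=; apply: leq_trans (leq_addl _ _).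
    apply: leq_sum => x; rewrite !inE => /andP[+ xA].
    by rewrite xA /= -ltnNge.
  have := cardsID A0 A; rewrite (setIidPr A0A); nia.
have [x xA0|B BA0 [indB leB]] := @independent_of_degree_bound r A0 (c * 2) r_sym.
  move: (xA0); rewrite inE => /andP[_]; apply: leq_trans.
  apply/subset_leq_card/subsetP => y; rewrite !inE => /andP[/andP[-> _]].
  by [].
exists B; first exact: subset_trans BA0 A0A.
by split=> //; apply: leq_trans le_A _; rewrite leq_mul2l /= mulnC.
Qed.

End Counting.

(** * Orienting a degenerate graph *)

Definition nbrs_in (G : sgraph) (A : {set G}) (v : G) : {set G} :=
  [set u in A | adj v u].

(** Vertices of small degree are peeled off one by one, and the edges from a peeled vertex to the
    remaining ones are oriented away from it. *)
Lemma degenerate_orientation (G : sgraph) (k : nat) :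
  (forall A : {set G}, A != set0 -> exists2 v, v \in A & #|nbrs_in A v| <= k) ->
  exists o : rel G, [/\ forall u v, o u v -> adj u v,
    forall u v, adj u v -> o u v || o v u &
    forall u, #|[set v | o u v]| <= k].
Proof.
move=> degen.
(* Arcs leave only vertices of [A]. Hence the peeled vertex has no out-arcs in the orientation given
   by induction, and adding at most [k] is safe. *)
suff orientA (n : nat) (A : {set G}) : #|A| = n -> exists o : rel G,
    [/\ forall u v, o u v -> adj u v && (u \in A),
        {in A &, forall u v, adj u v -> o u v || o v u} &
        forall u, #|[set v | o u v]| <= k].
  have [o [o1 o2 o3]] := orientA _ [set: G] erefl.
  by exists o; split=> // u v; [case/o1/andP | apply: o2].
elim: n A => [|n IHn] A cardA.
  move/eqP: cardA; rewrite cards_eq0 => /eqP ->.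
  exists (fun _ _ => false); split=> // [u v|u]; first by rewrite inE.
  by rewrite (_ : [set _ | _] = set0) ?cards0 //; apply/setP => v; rewrite !inE.
have [|v vA degv] := degen A; first by rewrite -card_gt0 cardA.
have [|o [o1 o2 o3]] := IHn (A :\ v).
  by move: cardA; rewrite (cardsD1 v) vA => -[].
exists (fun u w => o u w || (u == v) && (w \in nbrs_in A v)); split.
- move=> u w /orP[/o1/andP[-> /setD1P[_ ->]]//|/andP[/eqP->]].
  by rewrite inE vA => /andP[_ ->].
- move=> u w uA wA auw; rewrite !inE uA wA /=.
  have [uv|uv] := eqVneq u v; first by rewrite -uv auw orbT.
  have [wv|wv] := eqVneq w v; first by rewrite -wv adj_sym auw !orbT.
  by rewrite !orbF o2 // !inE ?uv ?wv.
move=> u; have [->|uv] := eqVneq u v.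
  apply: leq_trans degv; apply/subset_leq_card/subsetP => w.
  by rewrite !inE => /orP[/o1|//]; rewrite !inE eqxx andbF.
apply: leq_trans (o3 u); apply/subset_leq_card/subsetP => w.
by rewrite !inE orbF.
Qed.

(** The summands count, per vertex of [T]: out-neighbors, in-neighbors, ends sharing an
    out-neighbor, ends of directed 2-paths out and in, and ends sharing an in-neighbor. *)
Definition conflict_bound (k M : nat) : nat :=
  k + 2 * k.+1 + k * (2 * k.+1) + k * k + k * k + (3 + 2 * M) * (k * k).

(** * Bounding domination through an orientation of bounded outdegree *)

Section Orientation.
Variables (G : sgraph) (o : rel G) (k : nat).
Hypothesis o_adj : forall u v, o u v -> adj u v.
Hypothesis adj_o : forall u v, adj u v -> o u v || o v u.
Hypothesis outdeg : forall u, #|[set v | o u v]| <= k.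

Let outc (u : G) : {set G} := u |: [set v | o u v].
Let load (S : {set G}) (v : G) := #|[set s in S | v \in outc s]|.
(** Twice the largest possible closed out-neighborhood; this factor 2 is what makes the saturated
    vertices at most half as many as [S]. *)
Let L := 2 * k.+1.

Lemma card_outc u : #|outc u| <= k.+1.
Proof. by rewrite cardsU1 -add1n leq_add ?leq_b1 ?outdeg. Qed.

Lemma saturated_packing : exists S : {set G}, let Sat := [set v | L <= load S v] in
  [/\ forall v, load S v <= L, 2 * #|Sat| <= #|S| &
      forall x, x \notin S -> exists2 y, y \in outc x & y \in Sat].
Proof.
have [|S maxS] := @ex_maxset G (fun S => [forall v, load S v <= L]).
  exists set0; apply/forallP => v.
  by rewrite /load (_ : [set _ in _ | _] = set0) ?cards0 //;
     apply/setP => u; rewrite !inE.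
have /forallP loadS := maxsetp maxS.
exists S => Sat; split=> // [|x xS].
  have : L * #|Sat| <= #|S| * k.+1.
    rewrite mulnC -!sum_nat_const.
    apply: (@leq_trans (\sum_(v in Sat) load S v)).
      by apply: leq_sum => v; rewrite inE.
    rewrite /load -(double_counting S Sat (fun s v => v \in outc s)).
    apply: leq_sum => s _; apply: leq_trans (card_outc s).
    by apply/subset_leq_card/subsetP => v; rewrite inE => /andP[].
  rewrite /L; nia.
(* If no vertex of [outc x] is saturated, adding [x] to [S] keeps every load at most [L], against
   maximality. *)
apply/exists_inP; apply: contraR xS => /exists_inPn free.
have loadxS : [forall v, load (x |: S) v <= L].
  apply/forallP => v; have [vx|vx] := boolP (v \in outc x).
    have := free v vx; rewrite inE -ltnNge; apply: leq_trans.
    rewrite -add1n; apply: leq_trans (_ : _ <= #|[set x]| + load S v) _.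
      apply: leq_trans (leq_card_setU _ _).
      apply/subset_leq_card/subsetP => s; rewrite !inE.
      by case: (s == x).
    by rewrite cards1.
  apply: leq_trans (loadS v); apply/subset_leq_card/subsetP => s.
  rewrite !inE => /andP[/orP[/eqP->|->]//].
  by move: vx; rewrite !inE => /negbTE ->.
by have := maxsetsup maxS loadxS (subsetUr _ _) => <-; rewrite setU11.
Qed.

(** The hypothesis isolates the sparsity needed beyond the orientation. The factor 6 is 3 from
    passing from [gamma G] to [T], times 2 from the averaging in the conflict graph. *)
Lemma gamma_le_alpha2 (M : nat) :
  (forall X B : {set G}, [disjoint X & B] ->
     {in X, forall x, 3 <= #|nbrs_in B x|} -> #|X| <= M * #|B|) ->
  gamma G <= 6 * ((conflict_bound k M * 2).+1 * alpha2 G).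
Proof.
move=> sparse; have [S [loadS cardSat coverS]] := saturated_packing.
set Sat := [set v | _] in cardSat coverS.
pose T := S :\: Sat.
have cardT : #|S| <= 2 * #|T|.
  have := cardsID Sat S; have := subset_leq_card (subsetIr S Sat).
  by rewrite -/T; lia.
have gammaT : gamma G <= 3 * #|T|.
  have domS : dominating (S :|: Sat).
    apply/forallP => v; rewrite inE.
    have [//|vS] := boolP (v \in S).
    have [y yv ySat] := coverS v vS.
    case/setU1P: yv ySat => [->->//|]; rewrite inE => /o_adj vy ySat.
    by apply/orP; right; apply/exists_inP; exists y; rewrite // inE ySat orbT.
    have [_ /(_ _ domS)] := gammaP G; have [+ _] := leq_card_setU S Sat; lia.
pose X := [set x | 1 < #|[set v in T | o x v]|].
(* The 3 bounds [S :|: Sat] and the 2 bounds [T :|: Sat], both in units of [#|T|], since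
   [#|S| <= 2 * #|T|] and [#|Sat| <= #|T|]. *)
have cardX : #|X| <= (3 + 2 * M) * #|T|.
  pose X' := X :\: (S :|: Sat).
  have X'T : #|X'| <= M * #|T :|: Sat|.
    apply: sparse => [|x].
      rewrite -setI_eq0; apply/eqP/setP => x; rewrite !inE.
      by case: (x \in S); case: (_ <= _); rewrite ?andbF.
    rewrite 2!inE negb_or => /andP[/andP[xS xSat]]; rewrite inE => xT.
    have [y yx ySat] := coverS x xS.
    have oxy : o x y.
      by case/setU1P: yx ySat => [->|]; [rewrite (negbTE xSat)|rewrite inE].
    have yT : y \notin [set v in T | o x v] by rewrite !inE in ySat *; rewrite ySat.
    apply: (@leq_trans #|y |: [set v in T | o x v]|).
      by rewrite cardsU1 yT.
    apply/subset_leq_card/subsetP => z /setU1P[->|].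
      by rewrite inE (o_adj oxy) inE ySat orbT.
    by rewrite inE => /andP[zT /o_adj xz]; rewrite inE xz inE zT.
  have [+ _] := leq_card_setU T Sat; have [+ _] := leq_card_setU S Sat.
  have : #|X| <= #|X'| + #|S :|: Sat|.
    by rewrite -(cardsID (S :|: Sat) X) addnC leq_add2l subset_leq_card ?subsetIr.
  nia.
(* As [T] lies in [S], the load bounds in-neighbors from [T]; this handles arcs into a vertex and
   common out-neighbors. *)
have inT x : #|[set v in T | o v x]| <= L.
  apply: leq_trans (loadS x); apply/subset_leq_card/subsetP => v.
  by rewrite !inE => /andP[/andP[_ ->] ->]; rewrite orbT.
pose out u := [set v | o u v].
have outdeg2 u : #|\bigcup_(x in out u) out x| <= k * k.
  apply: leq_trans (card_bigcup_le (k := k) _) _ => [x _|]; first exact: outdeg.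
  by rewrite leq_mul2r outdeg orbT.
(* The four cases are the orientations of a path of length at most two from [u]
   to [v]; only [E4], the common in-neighbor, needs sparsity. *)
pose E1 u := [set v in T | o u v || o v u || [exists x, o u x && o v x]].
pose E2 u := [set v in T | [exists x, o u x && o x v]].
pose E3 u := [set v in T | [exists x, o v x && o x u]].
pose E4 u := [set v in T | [exists x in X, o x u && o x v]].
have sumE1 : \sum_(u in T) #|E1 u| <= #|T| * (k + L + k * L).
  rewrite -sum_nat_const; apply: leq_sum => u _.
  apply: (@leq_trans #|out u :|: [set v in T | o v u] :|:
      \bigcup_(x in out u) [set v in T | o v x]|).
    apply/subset_leq_card/subsetP => v; rewrite inE => /andP[vT].
    case/orP=> [uv|/existsP[x /andP[ux vx]]]; rewrite in_setU; apply/orP.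
      by left; rewrite !(inE, vT) in uv *.
    by right; apply/bigcupP; exists x; rewrite inE ?vT.
  apply: leq_trans (leq_card_setU _ _) _; apply: leq_add.
    apply: leq_trans (leq_card_setU _ _) _; apply: leq_add; first exact: outdeg.
    exact: inT.
  apply: leq_trans (card_bigcup_le (k := L) _) _ => [x _|]; first exact: inT.
  by rewrite leq_mul2r outdeg orbT.
have sumE2 : \sum_(u in T) #|E2 u| <= #|T| * (k * k).
  rewrite -sum_nat_const; apply: leq_sum => u _.
  apply: leq_trans (outdeg2 u); apply/subset_leq_card/subsetP => v.
  rewrite inE => /andP[_ /existsP[x /andP[ux xv]]].
  by apply/bigcupP; exists x; rewrite inE.
have sumE3 : \sum_(u in T) #|E3 u| <= #|T| * (k * k).
  (* [E3] is the transpose of [E2], so exchanging the roles of the ends yields [sumE2]. *)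
  by rewrite double_counting.
have sumE4 : \sum_(u in T) #|E4 u| <= #|X| * (k * k).
  (* Each [x] in [X] is charged for at most [k] choices of [u] and [k] of [v]. *)
  apply: (@leq_trans (\sum_(u in T) \sum_(x in [set x in X | o x u]) k)).
    apply: leq_sum => u _; rewrite sum_nat_const.
    apply: leq_trans (card_bigcup_le (F := out) (k := k) _); last first.
      by move=> x _; apply: outdeg.
    apply/subset_leq_card/subsetP => v.
    rewrite inE => /andP[_ /exists_inP[x xX /andP[xu xv]]].
    by apply/bigcupP; exists x; rewrite !inE // xu andbT; rewrite inE in xX.
  under eq_bigr => u _ do rewrite sum_nat_const.
  rewrite -big_distrl /= -(double_counting X T o) mulnA leq_mul2r; apply/orP; right.
  rewrite -sum_nat_const; apply: leq_sum => x _; apply: leq_trans (outdeg x).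
  by apply/subset_leq_card/subsetP => v; rewrite !inE => /andP[].
have sumT : \sum_(u in T) #|[set v in T | (v != u) && near2 u v]| <=
    conflict_bound k M * #|T|.
  apply: (@leq_trans (\sum_(u in T) (#|E1 u| + #|E2 u| + #|E3 u| + #|E4 u|))).
    apply: leq_sum => u uT.
    apply: (@leq_trans #|E1 u :|: E2 u :|: E3 u :|: E4 u|).
      apply/subset_leq_card/subsetP => v; rewrite inE => /and3P[vT vu uv].
      rewrite !in_setU -!orbA; apply/or4P.
      case/orP: uv => [/adj_o uv|/existsP[x /andP[/adj_o ux /adj_o xv]]].
        by apply: Or41; rewrite inE vT uv.
      case/orP: ux => [ux|xu]; case/orP: xv => [xv|vx].
      - by apply: Or42; rewrite inE vT; apply/existsP; exists x; rewrite ux.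
      - apply: Or41; rewrite inE vT; apply/orP; right.
        by apply/existsP; exists x; rewrite ux.
      - apply: Or44; rewrite inE vT; apply/exists_inP; exists x; last by rewrite xu.
        (* The distinct ends [u] and [v] are two out-neighbors of [x] in [T], which puts [x] in
           [X]. *)
        rewrite inE; have <- : #|[set u; v]| = 2 by rewrite cards2 eq_sym vu.
        apply/subset_leq_card/subsetP => w /set2P[]->.
          by rewrite inE uT.
        by rewrite inE vT.
      - by apply: Or43; rewrite inE vT; apply/existsP; exists x; rewrite vx.
    do 3![apply: leq_trans (leq_card_setU _ _) _; apply: leq_add => //].
  rewrite !big_split /= /conflict_bound -/L.
  have : #|X| * (k * k) <= (3 + 2 * M) * #|T| * (k * k) by rewrite leq_mul2r cardX orbT.
  move: sumE1 sumE2 sumE3 sumE4; lia.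
have [B BT [indB leTB]] := independent_of_average_degree_bound (@near2_sym G) sumT.
have : #|B| <= alpha2 G by apply/card_le_alpha2/two_independentP.
move: gammaT leTB; rewrite -!(mulnA, mulnC #|B|); nia.
Qed.
End Orientation.

(** * The extremal graphs for the threshold 6 *)

(* The pairs include [(i, i)], which also puts [i] within distance 2 of the apex. *)
Definition apex_pair_vertex (n : nat) : finType :=
  ('I_n + ('I_n * 'I_n) + unit)%type.

Definition pair_sees (n : nat) (p : 'I_n * 'I_n) (x : apex_pair_vertex n) : bool :=
  match x with
  | inl (inl i) => (i == p.1) || (i == p.2)
  | inl (inr _) => false
  | inr _ => true
  end.

Definition apex_pair_adj (n : nat) : rel (apex_pair_vertex n) := fun x y =>
  match x, y with
  | inl (inr p), _ => pair_sees p y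
  | _, inl (inr p) => pair_sees p x
  | _, _ => false
  end.

Lemma apex_pair_sym n : symmetric (@apex_pair_adj n).
Proof. by move=> [[i|p]|[]] [[j|q]|[]]. Qed.

Lemma apex_pair_irrefl n : irreflexive (@apex_pair_adj n).
Proof. by move=> [[i|p]|[]]. Qed.

Definition apex_pair_graph n := SGraph (@apex_pair_sym n) (@apex_pair_irrefl n).

Definition is_pair n (x : apex_pair_graph n) : bool :=
  if x is inl (inr _) then true else false.

(** Pair vertices meet at the apex, two base vertices meet at their pair, and [i] meets the apex at
    [(i, i)]. So a 2-independent set has at most one vertex of each kind. *)
Lemma apex_pair_near2 n (x y : apex_pair_graph n) :
  x != y -> is_pair x = is_pair y -> near2 x y.
Proof.
move=> xy exy; apply/orP; right; apply/existsP.
case: x y xy exy => [[i|p]|[]] [[j|q]|[]] //= _ _.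
- by exists (inl (inr (i, j))); rewrite /= !eqxx orbT.
- by exists (inl (inr (i, i))); rewrite /= !eqxx.
- by exists (inr tt).
- by exists (inl (inr (j, j))); rewrite /= !eqxx.
Qed.

Lemma alpha2_apex_pair n : alpha2 (apex_pair_graph n) <= 2.
Proof.
apply/bigmax_leqP => A /two_independentP indA.
have homogeneous (B : {set apex_pair_graph n}) :
    B \subset A -> {in B &, forall x y, is_pair x = is_pair y} -> #|B| <= 1.
  move=> BA eqB; apply/card_le1_eqP => x y xB yB; apply/eqP; apply: contraT.
  rewrite eq_sym => xy; have := indA _ _ (subsetP BA _ xB) (subsetP BA _ yB).
  by move/(_ xy); rewrite (apex_pair_near2 xy (eqB _ _ xB yB)).
rewrite -(cardsID [set x | is_pair x] A).
apply: (@leq_add _ _ 1 1); apply: homogeneous; rewrite ?subsetIl ?subsetDl //.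
  by move=> x y; rewrite !inE => /andP[_ ->] /andP[_ ->].
by move=> x y; rewrite !inE => /andP[/negbTE-> _] /andP[/negbTE-> _].
Qed.

Lemma gamma_apex_pair n : n <= 2 * gamma (apex_pair_graph n).
Proof.
have [[D /forallP domD <-] _] := gammaP (apex_pair_graph n).
(* The base vertices in the closed neighborhood of [x]: never more than two. *)
pose base (x : apex_pair_graph n) : {set 'I_n} :=
  match x with
  | inl (inl i) => [set i]
  | inl (inr p) => [set p.1; p.2]
  | inr _ => set0
  end.
rewrite -[leqLHS]card_ord mulnC.
apply: (@leq_trans #|\bigcup_(x in D) base x|).
  apply/subset_leq_card/subsetP => i _; apply/bigcupP.
  have /orP[iD|/exists_inP[x xD]] := domD (inl (inl i)).
    by exists (inl (inl i)); rewrite //= inE.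
  case: x xD => [[j|p]|[]] //= xD ip.
  by exists (inl (inr p)); rewrite //= !inE.
apply: card_bigcup_le => [[[i|p]|[]]] _ /=.
- by rewrite cards1.
- by rewrite cards2; case: eqP.
- by rewrite cards0.
Qed.

(** * Degree sums of subgraphs *)

Lemma card_edge (G : sgraph) (e : {set G}) : e \in edges G -> #|e| <= 2.
Proof.
by rewrite inE => /existsP[x /existsP[y /andP[_ /eqP->]]]; rewrite cards2; case: eqP.
Qed.

Lemma degree_le_nbrs (G : sgraph) (H : {set G} * {set {set G}}) (v : G) :
  H.2 \subset edges G -> degree H v <= #|[set u | adj v u]|.
Proof.
move=> HG; apply: leq_trans (leq_imset_card (fun u => [set v; u]) _).
apply/subset_leq_card/subsetP => e; rewrite inE => /andP[/(subsetP HG)].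
rewrite inE => /existsP[x /existsP[y /andP[xy /eqP->]]] /set2P[->|->].
  by apply/imsetP; exists y; rewrite ?inE.
by apply/imsetP; exists x; rewrite ?inE 1?adj_sym // setUC.
Qed.

(** An edge contributes at most 2 to the degree sum and at least 1 to the part over [W], so the
    whole sum is at most twice that part. *)
Lemma degree_sum_cover (G : sgraph) (W : {set G}) k (H : {set G} * {set {set G}}) :
  is_subgraph H ->
  (forall x y : G, adj x y -> (x \in W) || (y \in W)) ->
  {in W, forall x, #|[set u | adj x u]| <= k} ->
  \sum_(v in H.1) degree H v <= 2 * k * #|H.1|.
Proof.
case/andP=> HG /forall_inP HV coverW degW.
rewrite /degree (double_counting H.1 H.2 (fun v e => v \in e)).
apply: (@leq_trans (\sum_(e in H.2) 2 * #|[set v in H.1 :&: W | v \in e]|)).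
  apply: leq_sum => e eH; have eG := subsetP HG e eH.
  apply: (@leq_trans 2).
    apply: leq_trans (card_edge eG); apply/subset_leq_card/subsetP => v.
    by rewrite inE => /andP[].
  rewrite -[leqLHS]muln1 leq_mul2l /=; apply/card_gt0P.
  move: (eG) (HV e eH); rewrite inE => /existsP[x /existsP[y /andP[xy /eqP->]]].
  move/subsetP=> eV; case/orP: (coverW x y xy) => vW.
    by exists x; rewrite !inE vW eqxx eV ?set21.
  by exists y; rewrite !inE vW eqxx eV ?set22 ?orbT.
rewrite -big_distrr /= -(double_counting (H.1 :&: W) H.2 (fun v e => v \in e)).
rewrite -mulnA leq_mul2l /=.
apply: (@leq_trans (\sum_(v in H.1 :&: W) k)).
  apply: leq_sum => v /setIP[_ vW].
  by apply: leq_trans (degW v vW); apply: degree_le_nbrs.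
by rewrite sum_nat_const mulnC leq_mul2l subset_leq_card ?subsetIl ?orbT.
Qed.

Lemma card_pair_nbrs n (p : 'I_n * 'I_n) :
  #|[set u : apex_pair_graph n | adj (inl (inr p) : apex_pair_graph n) u]| <= 3.
Proof.
pose s : {set apex_pair_graph n} := [set inl (inl p.1); inl (inl p.2); inr tt].
apply: (@leq_trans #|s|).
  apply/subset_leq_card/subsetP => -[[i|q]|[]]; rewrite !inE //=.
  by case/orP=> /eqP ->; rewrite eqxx ?orbT.
apply: leq_trans (leq_card_setU _ _) _; rewrite cards1 addn1 ltnS cards2.
by case: eqP.
Qed.

Local Open Scope ring_scope.

Lemma mad_apex_pair (R : realType) n : mad R (apex_pair_graph n) <= 6.
Proof.
apply: bigmax_le => // H /andP[subH nH].
rewrite /average_degree ler_pdivrMr ?ltr0n ?card_gt0 // -natrM ler_nat.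
apply: (@degree_sum_cover _ [set x | is_pair x] 3) => //.
  by move=> [[i|p]|[]] [[j|q]|[]]; rewrite !inE.
by move=> [[i|p]|[]]; rewrite inE // => _; apply: card_pair_nbrs.
Qed.

Lemma mad_induced (R : realType) (G : sgraph) (A : {set G}) : A != set0 ->
  (\sum_(v in A) #|nbrs_in A v|)%:R <= mad R G * #|A|%:R.
Proof.
move=> nA; rewrite -ler_pdivrMr ?ltr0n ?card_gt0 //.
(* The induced subgraph on [A]; its degrees dominate neighbor counts because [u] is recovered from
   the edge [[set v; u]]. *)
pose H := (A, [set e in edges G | e \subset A]).
have subH : is_subgraph H && (H.1 != set0).
  rewrite nA andbT; apply/andP; split; first by apply/subsetP => e; rewrite inE => /andP[].
  by apply/forall_inP => e; rewrite inE => /andP[].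
have le_mad : average_degree R H <= mad R G.
  exact: (@le_bigmax_cond _ _ _ 0 H
    (fun H => is_subgraph H && (H.1 != set0)) (average_degree R (G := G)) subH).
apply: le_trans le_mad; rewrite /average_degree.
rewrite ler_pM2r ?invr_gt0 ?ltr0n ?card_gt0 // ler_nat.
apply: leq_sum => v vA; have nbr_neq u : u \in nbrs_in A v -> u != v.
  by rewrite inE => /andP[_]; apply: contraTneq => ->; rewrite adj_irrefl.
rewrite -(@card_in_imset _ _ (fun u => [set v; u])).
  apply/subset_leq_card/subsetP => _ /imsetP[u uv ->].
  move: uv; rewrite !inE => /andP[uA vu]; rewrite eqxx subUset !sub1set vA uA !andbT.
  by apply/existsP; exists v; apply/existsP; exists u; rewrite vu eqxx.
move=> u w /nbr_neq uv _ /setP/(_ u); rewrite !inE eqxx (negbTE uv) /=.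
by move/esym/eqP.
Qed.

(** * Consequences of small maximum average degree *)

Section SmallMad.
Variables (R : realType) (d : R) (G : sgraph).
Hypothesis madG : mad_class d G.

Lemma mad_class_induced (A : {set G}) :
  A != set0 -> (\sum_(v in A) #|nbrs_in A v|)%:R <= d * #|A|%:R.
Proof. by move=> nA; apply: le_trans (mad_induced R nA) _; rewrite ler_wpM2r. Qed.

Lemma mad_class_degenerate (k : nat) : d < k.+1%:R ->
  forall A : {set G}, A != set0 -> exists2 v, v \in A & (#|nbrs_in A v| <= k)%N.
Proof.
move=> dk A nA; apply/exists_inP; apply: contraT => /exists_inPn degA.
have : k.+1%:R * #|A|%:R <= d * #|A|%:R.
  apply: le_trans (mad_class_induced nA); rewrite -natrM ler_nat mulnC -sum_nat_const.
  by apply: leq_sum => v vA; rewrite ltnNge degA.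
by rewrite ler_pM2r ?ltr0n ?card_gt0 // leNgt dk.
Qed.

(** The at least [k * #|X|] edges between [X] and [B] are counted from both sides in the degree sum
    of [X :|: B]. *)
Lemma mad_class_bipartite (k : nat) (X B : {set G}) : [disjoint X & B] ->
  {in X, forall x, k <= #|nbrs_in B x|}%N ->
  X != set0 -> (2 * k)%N%:R * #|X|%:R <= d * (#|X|%:R + #|B|%:R).
Proof.
move=> dXB degX nX.
have nXB : X :|: B != set0.
  by apply: contraNneq nX => XB; rewrite -subset0 -XB subsetUl.
have := mad_class_induced nXB; rewrite cardsU (disjoint_setI0 dXB) cards0 subn0 natrD.
apply: le_trans; rewrite -natrM ler_nat.
rewrite (eq_bigl _ _ (fun x => in_setU x X B)) bigU //= -mulnA mul2n -addnn leq_add //.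
  rewrite mulnC -sum_nat_const; apply: leq_sum => x xX.
  apply: leq_trans (degX x xX) _; apply/subset_leq_card/subsetP => y.
  by rewrite !inE => /andP[-> ->]; rewrite orbT.
apply: (@leq_trans (\sum_(y in B) #|[set x in X | adj x y]|)).
  rewrite -(double_counting X B (@adj G)) mulnC -sum_nat_const.
  by apply: leq_sum => x xX; apply: degX.
apply: leq_sum => y _; apply/subset_leq_card/subsetP => x.
by rewrite !inE adj_sym => /andP[-> ->].
Qed.
End SmallMad.

Theorem corollary8 (R : realType) (d : R) :
  (d < 6 -> bounded_domination_ratio R (mad_class d)) /\
  (6 <= d -> ~ domination_tied R (mad_class d)).
Proof.
split=> [d6|d6 [h tied]].
  (* With [k = 3] the bipartite bound reads [(6 - d) * #|X| <= d * #|B|], and [d < 6] turns the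
     right side into [6 * #|B|]. *)
  pose M := Num.bound (6 / (6 - d)).
  exists (6 * (conflict_bound 5 M * 2).+1)%N%:R => G madG.
  rewrite -natrM ler_nat -mulnA.
  have [o [o1 o2 o3]] := degenerate_orientation (mad_class_degenerate madG d6).
  apply: (gamma_le_alpha2 o1 o2 o3) => X B dXB degX.
  have [->|nX] := eqVneq X set0; first by rewrite cards0.
  have := mad_class_bipartite madG dXB degX nX => edgesXB.
  rewrite -(ler_nat R) (natrM _ M).
  have d60 : 0 < 6 - d by rewrite subr_gt0.
  apply: (@le_trans _ _ (6 / (6 - d) * #|B|%:R)).
    rewrite mulrAC ler_pdivlMr //.
    have : 0 <= (6 - d) * #|B|%:R by rewrite mulr_ge0 // ltW.
    lra.
  by apply: ler_wpM2r; rewrite // ltW // archi_boundP // divr_ge0 // ltW.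
(* Since [alpha2] is at most 2, only [h 0], [h 1] and [h 2] matter; absolute values let one sum
   bound all three, and [n] exceeds twice that sum. *)
pose n := Num.bound (2 * (`|h 0| + `|h 1| + `|h 2|)).
have /tied : mad_class d (apex_pair_graph n) by apply: le_trans d6; apply: mad_apex_pair.
apply/negP; rewrite -ltNge.
apply: (@le_lt_trans _ _ (`|h 0| + `|h 1| + `|h 2|)).
  have := normr_ge0 (h 0); have := normr_ge0 (h 1); have := normr_ge0 (h 2).
  have := alpha2_apex_pair n; case: alpha2 => [|[|[|//]]] _.
  - have := ler_norm (h 0); lra.
  - have := ler_norm (h 1); lra.
  - have := ler_norm (h 2); lra.
rewrite -(ltr_pM2l (ltr0n R 2)).
have : n%:R <= 2%:R * (gamma (apex_pair_graph n))%:R :> R.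
  by rewrite -natrM ler_nat gamma_apex_pair.
apply: lt_le_trans; apply: archi_boundP.
by rewrite mulr_ge0 // !addr_ge0.
Qed.
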